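(* For $p>1$ let $$\Delta(p):=\left(\frac1p\right)^{\frac1{p-1}}-\frac{p-1}{p}.$$ Then: (i) $\Delta(p)>0$ when $1<p<2$; $\Delta(2)=0$; and $\Delta(p)<0$ when $p>2$; (ii) $\lim_{p\to1}\Delta(p)=e^{-1}$ and $\lim_{p\to\infty}\Delta(p)=0$; (iii) $\Delta(p)$ is minimized (over $p>1$) at $p_0$, where $p_0\approx6.3212$; (iv) for all $p>1$, $0.3679\approx e^{-1}\ge\Delta(p)\ge\Delta(p_0)\approx-0.1347$.
   Context: The symbol $\approx$ denotes numerical approximation to the number of decimal places displayed. The limit $p\to1$ is taken from the right. *)

(* Defs.v *)
From Stdlib Require Import Reals.
From Coquelicot Require Import Coquelicot.
Open Scope R_scope.

(* The name [Delta] is taken by Stdlib (discriminant of a quadratic).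
   [Rpower] is exponentiation with real exponent, correct since [0 < 1 / p]. *)
Definition Delta_ (p : R) : R := Rpower (1 / p) (1 / (p - 1)) - (p - 1) / p.

(* [a] is the value of [x] rounded to [n] decimal places. *)
Definition approx (n : nat) (x a : R) : Prop := Rabs (x - a) <= / 2 * / 10 ^ n.

(* Main.v *)
Require Import Defs.
From Stdlib Require Import Reals Lra.
From Coquelicot Require Import Coquelicot.
Open Scope R_scope.

(** Write [s p = ln p / (p - 1)], called [slope] below; then
    [Delta_ p = exp (- s p) - (1 - / p)].

    Sign. Comparing the logarithms of the two terms, [Delta_ p] has the sign
    of [(p - 2) ln p - (p - 1) ln (p - 1)]. This is strict concavity of the
    logarithm on the points [1], [p - 1], [p]: the middle one is [p - 1] when
    [2 < p] and [1] when [p < 2], which reverses the inequality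
    ([Delta_neg], [Delta_pos]).

    Bounds and limits. From [1 - / p <= ln p <= p - 1] one gets
    [/ p <= s p <= 1]. The upper bound gives [exp (-1) - (1 - / p) <= Delta_ p].
    The lower one gives [exp (- s p) <= exp (-1) * exp u] with [u = 1 - / p],
    and [exp u <= 1 + exp 1 * u] on [0, 1] turns this into
    [Delta_ p <= exp (-1)] ([Delta_le_exp_m1]); the limit at [1] follows by
    squeezing. At infinity, [- s p <= Delta_ p < 0].

    Minimum. The derivative of [Delta_] is [(exp (K p) - 1) / p ^ 2], where
    [K], called [log_ratio] below, is the logarithm of the ratio of the positive
    part of the derivative to its negative part. Over a positive denominator,
    [K'] has numerator [(p ln p - 2 (p - 1))^2 + (p - 1)^2 (p - 2)], so [K]
    increases on [2 < p] ([log_ratio_incr]). If [K a < 0 < K b], then [Delta_]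
    decreases before [a] and increases after [b], hence its minimum over the
    compact interval [a, b] is global: for [p <= 2] the value is nonnegative
    and cannot compete ([Delta_has_min]).

    Numerics. The signs of [K] at 6.32115 and 6.32125, the two ends of the
    rounding interval of 6.3212, reduce to bounds on [ln] and [exp] at rational
    points, which come from Taylor's formula for the exponential
    ([exp_taylor_bounds]). *)

(** * Elementary bounds on the logarithm and the exponential *)

Lemma ln_lt_sub_one (y : R) : 0 < y -> y <> 1 -> ln y < y - 1.
Proof.
intros Hy Hy1.
assert (H : 1 + ln y < exp (ln y)).
{ apply exp_ineq1. intro H0. apply Hy1. rewrite <- (exp_ln y Hy), H0. apply exp_0. }
rewrite exp_ln in H; lra.
Qed.

Lemma ln_le_sub_one (y : R) : 0 < y -> ln y <= y - 1.
Proof.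
intros Hy. generalize (exp_ineq1_le (ln y)). rewrite exp_ln; lra.
Qed.

Lemma ln_ge_one_sub_inv (y : R) : 0 < y -> 1 - / y <= ln y.
Proof.
intros Hy. generalize (ln_le_sub_one (/ y) (Rinv_0_lt_compat y Hy)).
rewrite ln_Rinv; lra.
Qed.

Lemma exp_le (x y : R) : x <= y -> exp x <= exp y.
Proof.
intros [H | ->]; [left; now apply exp_increasing | apply Rle_refl].
Qed.

(** Multiplying [1 - u <= exp (- u)] by [exp u] gives [exp u <= 1 + u * exp u],
    and the last factor is at most [exp 1]. *)
Lemma exp_le_one_add_exp1_mul (u : R) : 0 <= u <= 1 -> exp u <= 1 + exp 1 * u.
Proof.
intros Hu.
assert (E : exp u * exp (- u) = 1) by (rewrite <- exp_plus, Rplus_opp_r; apply exp_0).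
assert (H1 := exp_ineq1_le (- u)).
assert (H2 : exp u <= exp 1) by (apply exp_le; lra).
assert (H0 := exp_pos u).
assert (exp u * (1 + - u) <= exp u * exp (- u)) by (apply Rmult_le_compat_l; lra).
nra.
Qed.

Lemma inv_bounds (p : R) : 1 < p -> 0 < / p < 1.
Proof.
intros Hp. split; [apply Rinv_0_lt_compat; lra|].
rewrite <- Rinv_1. apply Rinv_lt_contravar; lra.
Qed.

(** * The two terms of Delta and the sign of their difference *)

(** The slope of the chord of [ln] between [1] and [p]. *)
Definition slope (p : R) : R := ln p / (p - 1).

Lemma Delta_slope (p : R) : 1 < p -> Delta_ p = exp (- slope p) - (1 - / p).
Proof.
intros Hp. unfold Delta_, Rpower, slope.
replace (1 / p) with (/ p) by (field; lra).
rewrite ln_Rinv by lra.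
replace (1 / (p - 1) * - ln p) with (- (ln p / (p - 1))) by (field; lra).
field; lra.
Qed.

Lemma slope_bounds (p : R) : 1 < p -> / p <= slope p <= 1.
Proof.
intros Hp. unfold slope.
generalize (ln_le_sub_one p ltac:(lra)) (ln_ge_one_sub_inv p ltac:(lra)); intros H1 H2.
split.
- apply Rle_div_r; [lra|].
  replace (/ p * (p - 1)) with (1 - / p) by (field; lra). exact H2.
- apply Rle_div_l; lra.
Qed.

Lemma one_sub_inv_exp (p : R) : 1 < p -> 1 - / p = exp (ln (p - 1) - ln p).
Proof.
intros Hp.
unfold Rminus at 2; rewrite exp_plus, exp_Ropp, !exp_ln by lra.
field; lra.
Qed.

Lemma ln_ratio_add_slope (p : R) : 1 < p ->
  ln (p - 1) - ln p + slope p
  = ((p - 1) * ln (p - 1) - (p - 2) * ln p) / (p - 1).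
Proof. intros Hp. unfold slope. field; lra. Qed.

(** The point [1] is the average of [p - 1] and [p] with weights [p - 1] and
    [2 - p], so strict concavity says that the corresponding average of [ln] is
    below [ln 1 = 0]; the tangent at [1] proves it. *)
Lemma Delta_pos (p : R) : 1 < p < 2 -> 0 < Delta_ p.
Proof.
intros Hp. rewrite Delta_slope, one_sub_inv_exp by lra.
enough (ln (p - 1) - ln p < - slope p) by (generalize (exp_increasing _ _ H); lra).
enough (ln (p - 1) - ln p + slope p < 0) by lra.
rewrite ln_ratio_add_slope by lra. apply Rlt_div_l; [lra|]. rewrite Rmult_0_l.
generalize (ln_lt_sub_one p ltac:(lra) ltac:(lra)).
generalize (ln_lt_sub_one (p - 1) ltac:(lra) ltac:(lra)).
nra.
Qed.

(** The point [p - 1] is now the average of [1] and [p] with weights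
    [/ (p - 1)] and [(p - 2) / (p - 1)]; strict concavity comes from the tangent
    at [p - 1], that is, from [ln y < y - 1] at [y = x / (p - 1)] for [x = 1]
    and [x = p]. *)
Lemma Delta_neg (p : R) : 2 < p -> Delta_ p < 0.
Proof.
intros Hp. rewrite Delta_slope, one_sub_inv_exp by lra.
enough (- slope p < ln (p - 1) - ln p) by (generalize (exp_increasing _ _ H); lra).
enough (0 < ln (p - 1) - ln p + slope p) by lra.
rewrite ln_ratio_add_slope by lra. apply Rdiv_lt_0_compat; [|lra].
assert (H1 : ln (/ (p - 1)) < / (p - 1) - 1).
{ apply ln_lt_sub_one; [apply Rinv_0_lt_compat; lra|].
  apply Rlt_not_eq. rewrite <- Rinv_1. apply Rinv_lt_contravar; lra. }
assert (H2 : ln (p / (p - 1)) < p / (p - 1) - 1).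
{ apply ln_lt_sub_one; [apply Rdiv_lt_0_compat; lra|].
  apply Rgt_not_eq. apply Rlt_gt, Rlt_div_r; lra. }
unfold Rdiv in H2. rewrite ln_mult in H2 by (try (apply Rinv_0_lt_compat); lra).
rewrite ln_Rinv in H1, H2 by lra.
assert (E : p * / (p - 1) - 1 = / (p - 1)) by (field; lra).
assert (E' : (p - 2) * / (p - 1) = 1 - / (p - 1)) by (field; lra).
assert ((p - 2) * (ln p + - ln (p - 1)) < (p - 2) * / (p - 1))
  by (apply Rmult_lt_compat_l; lra).
lra.
Qed.

Lemma Delta_2 : Delta_ 2 = 0.
Proof.
rewrite Delta_slope, one_sub_inv_exp by lra. unfold slope.
replace (2 - 1) with 1 by ring. rewrite ln_1.
replace (- (ln 2 / 1)) with (0 - ln 2) by field. ring.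
Qed.

(** * Upper bound and limits *)

Lemma Delta_le_exp_m1 (p : R) : 1 < p -> Delta_ p <= exp (-1).
Proof.
intros Hp. rewrite Delta_slope by lra.
generalize (slope_bounds p Hp) (inv_bounds p Hp); intros Hs Hi.
assert (H1 : exp (- slope p) <= exp (-1) * exp (1 - / p)).
{ rewrite <- exp_plus. apply exp_le. lra. }
assert (H2 : exp (1 - / p) <= 1 + exp 1 * (1 - / p)) by (apply exp_le_one_add_exp1_mul; lra).
assert (E : exp (-1) * exp 1 = 1).
{ rewrite <- exp_plus. replace (-1 + 1) with 0 by ring. apply exp_0. }
generalize (exp_pos (-1)); nra.
Qed.

Lemma Delta_lim_1 : filterlim Delta_ (at_right 1) (locally (exp (-1))).
Proof.
apply (filterlim_le_le (F := at_right 1)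
         (fun p => exp (-1) - (1 - / p)) Delta_ (fun _ => exp (-1)) (exp (-1))).
- exists (mkposreal 1 Rlt_0_1). intros p _ Hp. split.
  + rewrite Delta_slope by lra.
    assert (exp (-1) <= exp (- slope p))
      by (apply exp_le; generalize (slope_bounds p Hp); lra).
    lra.
  + now apply Delta_le_exp_m1.
- apply (filterlim_filter_le_1 (F := locally 1) _ (filter_le_within _)).
  assert (C : continuous (fun p => exp (-1) - (1 - / p)) 1).
  { apply (ex_derive_continuous (fun p => exp (-1) - (1 - / p)) 1). auto_derive. lra. }
  unfold continuous in C. rewrite Rinv_1, Rminus_diag, Rminus_0_r in C. exact C.
- apply filterlim_const.
Qed.

(** Since [1 + x <= exp x], the value is at least [- slope p], and [slope p] is
    at most [2 * ln p / p] once [2 < p]. *)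
Lemma Delta_lim_infty : is_lim Delta_ p_infty 0.
Proof.
apply (is_lim_le_le_loc (fun p => - 2 * (ln p / p)) (fun _ => 0)).
- exists 2. intros p Hp. split.
  + rewrite Delta_slope by lra.
    generalize (exp_ineq1_le (- slope p)) (inv_bounds p ltac:(lra)); intros H1 H2.
    enough (slope p <= 2 * (ln p / p)) by lra.
    unfold slope. apply Rle_div_l; [lra|].
    assert (0 < ln p) by (rewrite <- ln_1; apply ln_increasing; lra).
    assert (E : 2 * (ln p / p) * (p - 1) = ln p + ln p * ((p - 2) * / p)) by (field; lra).
    rewrite E.
    assert (0 <= ln p * ((p - 2) * / p)) by (repeat apply Rmult_le_pos; lra).
    lra.
  + left. now apply Delta_neg.
- replace (Finite 0) with (Rbar_mult (-2) 0) by (simpl; f_equal; ring).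
  apply is_lim_scal_l, is_lim_div_ln_p.
- apply is_lim_const.
Qed.

(** * Monotonicity and existence of the minimum *)

(** The derivative of [Delta_] is [- exp (- slope p) * slope' p - / p ^ 2]; this
    is the logarithm of the first term times [p ^ 2], as [exp_log_ratio] makes
    explicit. Taking the logarithm makes its monotonicity a rational question
    in [p] and [ln p]. *)
Definition log_ratio (p : R) : R :=
  ln p + ln (p * ln p - p + 1) - 2 * ln (p - 1) - slope p.

(** This is [p] times the gap in [1 - / p < ln p]. *)
Lemma tangent_gap_pos (p : R) : 1 < p -> 0 < p * ln p - p + 1.
Proof.
intros Hp.
assert (Hi := inv_bounds p Hp).
assert (H := ln_lt_sub_one (/ p) ltac:(lra) ltac:(lra)).
rewrite ln_Rinv in H by lra.
assert (p * / p = 1) by (apply Rinv_r; lra).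
nra.
Qed.

Lemma exp_log_ratio (p : R) : 1 < p ->
  exp (log_ratio p) = p * (p * ln p - p + 1) / (p - 1) ^ 2 * exp (- slope p).
Proof.
intros Hp. assert (HA := tangent_gap_pos p Hp).
unfold log_ratio.
replace (ln p + ln (p * ln p - p + 1) - 2 * ln (p - 1) - slope p)
  with (ln p + ln (p * ln p - p + 1) + - ln (p - 1) + - ln (p - 1) + - slope p) by ring.
rewrite !exp_plus, (exp_Ropp (ln (p - 1))), !exp_ln by lra.
field; lra.
Qed.

Lemma is_derive_Delta (p : R) : 1 < p ->
  is_derive Delta_ p ((exp (log_ratio p) - 1) / p ^ 2).
Proof.
intros Hp.
apply (is_derive_ext_loc (fun q => exp (- slope q) - (1 - / q))).
- exists (mkposreal (p - 1) ltac:(lra)). intros q Hq.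
  symmetry. apply Delta_slope.
  change (Rabs (q - p) < p - 1) in Hq. apply Rabs_def2 in Hq. lra.
- unfold slope. auto_derive; [repeat split; lra|].
  rewrite exp_log_ratio by lra. unfold slope, Rdiv.
  change (p + - (1)) with (p - 1). field. lra.
Qed.

(** After reduction to a common denominator, the numerator is the quadratic
    [p ^ 2 L ^ 2 - 4 p (p - 1) L + (p - 1) ^ 2 (p + 2)] in [L = ln p]; it is
    written with its square completed, which shows its sign for [2 < p]. *)
Lemma is_derive_log_ratio (p : R) : 1 < p ->
  is_derive log_ratio p
    (((p * ln p - 2 * (p - 1)) ^ 2 + (p - 1) ^ 2 * (p - 2))
     / (p * (p - 1) ^ 2 * (p * ln p - p + 1))).
Proof.
intros Hp. assert (HA := tangent_gap_pos p Hp).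
unfold log_ratio, slope. auto_derive; [repeat split; lra|].
field. repeat split; lra.
Qed.

Lemma log_ratio_incr (p q : R) : 2 < p -> p < q -> log_ratio p < log_ratio q.
Proof.
intros Hp Hq.
apply (incr_function_le log_ratio p q (fun p =>
   ((p * ln p - 2 * (p - 1)) ^ 2 + (p - 1) ^ 2 * (p - 2))
     / (p * (p - 1) ^ 2 * (p * ln p - p + 1)))); simpl Rbar_le; try lra.
- intros x Hx _. apply is_derive_log_ratio. lra.
- intros x Hx _. assert (HA := tangent_gap_pos x ltac:(lra)).
  apply Rdiv_lt_0_compat.
  + apply Rplus_le_lt_0_compat; [apply pow2_ge_0|].
    apply Rmult_lt_0_compat; [apply pow_lt|]; lra.
  + apply Rmult_lt_0_compat; [|exact HA].
    apply Rmult_lt_0_compat; [|apply pow_lt]; lra.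
Qed.

Lemma Delta_decr (a p : R) :
  log_ratio a < 0 -> 2 < p -> p < a -> Delta_ a < Delta_ p.
Proof.
intros Ha Hp Hpa.
enough (- Delta_ p < - Delta_ a) by lra.
apply (incr_function_le (fun q => - Delta_ q) p a
         (fun q => - ((exp (log_ratio q) - 1) / q ^ 2))); simpl Rbar_le; try lra.
- intros x Hx _. apply (is_derive_opp Delta_). apply is_derive_Delta. lra.
- intros x Hx Hxa.
  assert (log_ratio x < 0).
  { destruct Hxa as [Hxa | ->]; [|lra].
    apply Rlt_trans with (log_ratio a); [apply log_ratio_incr; lra | lra]. }
  assert (exp (log_ratio x) < 1) by (rewrite <- exp_0; now apply exp_increasing).
  unfold Rdiv. rewrite Ropp_mult_distr_l.
  apply Rmult_lt_0_compat; [lra|]. apply Rinv_0_lt_compat, pow_lt. lra.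
Qed.

Lemma Delta_incr (b p : R) :
  2 < b -> 0 < log_ratio b -> b < p -> Delta_ b < Delta_ p.
Proof.
intros Hb Hb0 Hbp.
apply (incr_function_le Delta_ b p
         (fun q => (exp (log_ratio q) - 1) / q ^ 2)); simpl Rbar_le; try lra.
- intros x Hx _. apply is_derive_Delta. lra.
- intros x Hx Hxp.
  assert (0 < log_ratio x).
  { destruct Hx as [Hx | <-]; [|lra].
    apply Rlt_trans with (log_ratio b); [lra | apply log_ratio_incr; lra]. }
  assert (1 < exp (log_ratio x)) by (rewrite <- exp_0; now apply exp_increasing).
  apply Rdiv_lt_0_compat; [lra|]. apply pow_lt. lra.
Qed.

(** The minimum over [a, b] exists by compactness. It is global because every
    other point has a larger value than an endpoint of [a, b] or, for [p <= 2],
    a nonnegative value. *)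
Lemma Delta_has_min (a b : R) :
  2 < a -> a < b -> log_ratio a < 0 -> 0 < log_ratio b ->
  exists p0, a <= p0 <= b /\ forall p, 1 < p -> Delta_ p0 <= Delta_ p.
Proof.
intros Ha Hab Ka Kb.
destruct (continuity_ab_min Delta_ a b) as [p0 [Hmin Hp0]]; [lra | |].
{ intros c Hc. apply continuity_pt_filterlim.
  apply (ex_derive_continuous Delta_ c).
  eexists. apply is_derive_Delta. lra. }
exists p0. split; [exact Hp0|]. intros p Hp.
destruct (Rle_lt_dec p 2) as [Hp2 | Hp2].
{ assert (Delta_ p0 < 0) by (apply Delta_neg; lra).
  destruct Hp2 as [Hp2 | ->]; [|rewrite Delta_2; lra].
  generalize (Delta_pos p ltac:(lra)); lra. }
destruct (Rlt_le_dec p a) as [Hpa | Hpa].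
{ apply Rle_trans with (Delta_ a); [apply Hmin; lra|].
  left. now apply Delta_decr. }
destruct (Rle_lt_dec p b) as [Hpb | Hpb]; [apply Hmin; lra|].
apply Rle_trans with (Delta_ b); [apply Hmin; lra|].
left. apply Delta_incr; lra.
Qed.

(** * Numerical bounds *)

Definition exp_taylor_sum (n : nat) (x : R) : R :=
  sum_f_R0 (fun k => x ^ k / INR (Factorial.fact k)) n.

(** The Lagrange remainder is positive and, its intermediate point being below
    [x], at most [exp x] times the first omitted term. Moving that bound to the
    left keeps the estimate free of any prior upper bound on [exp x]. *)
Lemma exp_taylor_bounds (n : nat) (x : R) : 0 < x ->
  exp_taylor_sum n x <= exp x /\
  exp x * (1 - x ^ S n / INR (Factorial.fact (S n))) <= exp_taylor_sum n x.
Proof.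
intros Hx.
assert (D : forall k t, Derive_n exp k t = exp t)
  by (intros; apply is_derive_n_unique, is_derive_n_exp).
destruct (Taylor_Lagrange exp n 0 x Hx) as [z [Hz E]].
{ intros t _ [|k] _; [exact I|]. eexists. apply (is_derive_n_exp (S k)). }
rewrite D, Rminus_0_r in E.
assert (ET : sum_f_R0 (fun m => x ^ m / INR (Factorial.fact m) * Derive_n exp m 0) n
             = exp_taylor_sum n x).
{ apply sum_eq. intros i _. rewrite D, exp_0. ring. }
rewrite ET in E.
assert (Hr : 0 < x ^ S n / INR (Factorial.fact (S n))).
{ apply Rdiv_lt_0_compat; [now apply pow_lt | apply INR_fact_lt_0]. }
assert (Hz1 : exp z <= exp x) by (apply exp_le; lra).
assert (Hz0 := exp_pos z).
split; nra.
Qed.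

(* The factorials are unfolded into products before they become integers in
   binary: as unary numbers they would be too large to compute. *)
Ltac compute_exp_taylor_sum :=
  unfold exp_taylor_sum, sum_f_R0; rewrite ?fact_simpl, ?mult_INR;
  change (Factorial.fact 0) with 1%nat; rewrite ?INR_IZR_INZ;
  cbn [Z.of_nat Pos.of_succ_nat Pos.succ]; simpl pow; lra.

Lemma exp_gt_of_taylor (n : nat) (q y : R) : 0 < q -> y < exp_taylor_sum n q -> y < exp q.
Proof. intros Hq H. destruct (exp_taylor_bounds n q Hq). lra. Qed.

Lemma exp_lt_of_taylor (n : nat) (q y : R) : 0 < q ->
  0 < 1 - q ^ S n / INR (Factorial.fact (S n)) ->
  exp_taylor_sum n q < y * (1 - q ^ S n / INR (Factorial.fact (S n))) -> exp q < y.
Proof. intros Hq H0 H. destruct (exp_taylor_bounds n q Hq). nra. Qed.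

Ltac exp_bound n :=
  first [apply (exp_gt_of_taylor n); [lra | compute_exp_taylor_sum]
        |apply (exp_lt_of_taylor n); [lra | compute_exp_taylor_sum | compute_exp_taylor_sum]].

Lemma lt_ln_of_exp_lt (q y : R) : exp q < y -> q < ln y.
Proof.
intros H. rewrite <- (ln_exp q). apply ln_increasing; [apply exp_pos | exact H].
Qed.

Lemma ln_lt_of_lt_exp (q y : R) : 0 < y -> y < exp q -> ln y < q.
Proof. intros H0 H. rewrite <- (ln_exp q). now apply ln_increasing. Qed.

(** The precision is dictated by the sign of [log_ratio] at 6.32115: the zero,
    about 6.321165, is so close that the value there is about -1.6e-6. *)
Lemma ln_6_32115_bounds : 1.8439011 < ln 6.32115 < 1.8439012.
Proof. split; [apply lt_ln_of_exp_lt | apply ln_lt_of_lt_exp; [lra|]]; exp_bound 16%nat. Qed.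

Lemma ln_6_32125_bounds : 1.8439169 < ln 6.32125 < 1.8439170.
Proof. split; [apply lt_ln_of_exp_lt | apply ln_lt_of_lt_exp; [lra|]]; exp_bound 16%nat. Qed.

Lemma exp_slope_6_32115_gt : 1.41414 < exp (slope 6.32115).
Proof.
assert (Hl := ln_6_32115_bounds).
assert (Hs : 0.346523 < slope 6.32115) by (unfold slope; lra).
assert (He : 1.41414 < exp 0.346523) by exp_bound 8%nat.
assert (He' : exp 0.346523 < exp (slope 6.32115)) by now apply exp_increasing.
lra.
Qed.

(** In [exp_log_ratio], the first factor has to be compared with
    [exp (slope p)]. The number 1.41414 lies between the two, both here and, with
    the inequalities reversed, at 6.32125. *)
Lemma log_ratio_6_32115_neg : log_ratio 6.32115 < 0.
Proof.
assert (Hl := ln_6_32115_bounds).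
assert (Hs := exp_slope_6_32115_gt).
apply exp_lt_inv. rewrite exp_0, exp_log_ratio, exp_Ropp by lra.
apply Rlt_div_l; lra.
Qed.

Lemma log_ratio_6_32125_pos : 0 < log_ratio 6.32125.
Proof.
assert (Hl := ln_6_32125_bounds).
assert (Hs : slope 6.32125 < 0.34651953) by (unfold slope; lra).
assert (He : exp 0.34651953 < 1.41414) by exp_bound 8%nat.
assert (He' : exp (slope 6.32125) < exp 0.34651953) by now apply exp_increasing.
apply exp_lt_inv. rewrite exp_0, exp_log_ratio, exp_Ropp by lra.
apply Rlt_gt, Rlt_div_r; [apply exp_pos | lra].
Qed.

Lemma Delta_6_32115_lt : Delta_ 6.32115 < -0.13465.
Proof.
assert (Hs := exp_slope_6_32115_gt).
rewrite Delta_slope, exp_Ropp by lra.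
assert (/ exp (slope 6.32115) < / 1.41414).
{ apply Rinv_0_lt_contravar; lra. }
lra.
Qed.

Lemma Delta_gt_near_min (p : R) : 6.32115 <= p <= 6.32125 -> -0.13475 < Delta_ p.
Proof.
intros Hp.
assert (Hl : ln p < 1.8439170).
{ apply Rle_lt_trans with (ln 6.32125); [apply ln_le; lra | apply ln_6_32125_bounds]. }
assert (Hs : slope p < 0.34653) by (unfold slope; apply Rlt_div_l; lra).
assert (He : exp 0.34653 < 1.4142) by exp_bound 8%nat.
assert (He' : exp (slope p) < exp 0.34653) by now apply exp_increasing.
rewrite Delta_slope, exp_Ropp by lra.
assert (/ 1.4142 < / exp (slope p))
  by (apply Rinv_0_lt_contravar; [apply exp_pos | lra]).
assert (/ 6.32125 <= / p) by (apply Rinv_le_contravar; lra).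
lra.
Qed.

Lemma exp_m1_approx : approx 4 (exp (-1)) 0.3679.
Proof.
assert (H1 : 2.7182 < exp 1) by exp_bound 9%nat.
assert (H2 : exp 1 < 2.7183) by exp_bound 9%nat.
unfold approx. change (-1) with (- (1)). rewrite exp_Ropp.
assert (/ exp 1 < / 2.7182) by (apply Rinv_0_lt_contravar; lra).
assert (/ 2.7183 < / exp 1) by (apply Rinv_0_lt_contravar; lra).
apply Rabs_le. lra.
Qed.

Theorem proposition3p20 :
  ((forall p : R, 1 < p < 2 -> Delta_ p > 0) /\
   Delta_ 2 = 0 /\
   (forall p : R, p > 2 -> Delta_ p < 0)) /\
  (filterlim Delta_ (at_right 1) (locally (exp (-1))) /\
   is_lim Delta_ p_infty 0) /\
  (exists p0 : R,
     (1 < p0 /\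
      (forall p : R, 1 < p -> Delta_ p0 <= Delta_ p) /\
      approx 4 p0 6.3212) /\
     (approx 4 (exp (-1)) 0.3679 /\
      (forall p : R, 1 < p -> exp (-1) >= Delta_ p /\ Delta_ p >= Delta_ p0) /\
      approx 4 (Delta_ p0) (-0.1347))).
Proof.
split; [|split].
- split; [exact Delta_pos | split; [exact Delta_2 | exact Delta_neg]].
- split; [exact Delta_lim_1 | exact Delta_lim_infty].
- destruct (Delta_has_min 6.32115 6.32125) as [p0 [Hp0 Hmin]];
    [lra | lra | exact log_ratio_6_32115_neg | exact log_ratio_6_32125_pos |].
  exists p0. repeat split.
  + lra.
  + exact Hmin.
  + unfold approx. apply Rabs_le. lra.
  + exact exp_m1_approx.
  + apply Rle_ge. now apply Delta_le_exp_m1.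
  + apply Rle_ge. now apply Hmin.
  + assert (H1 := Delta_gt_near_min p0 Hp0).
    (* Minimality bounds the minimum above by the value at an endpoint. *)
    assert (H2 := Hmin 6.32115 ltac:(lra)).
    assert (H3 := Delta_6_32115_lt).
    unfold approx. apply Rabs_le. lra.
Qed.
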